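(* Let $\mathbf{F}_q$ be the finite field with $q$ elements and let $F(X_1,\dots,X_n)\in\mathbf{F}_q[X_1,\dots,X_n]$. There exists an $n$-tuple $(x_1,\dots,x_n)\in\mathbf{F}_q^n$ such that $F(x_1,\dots,x_n)\neq 0$ if and only if the remainder of $F(X_1,\dots,X_n)$ modulo $(X_1^q-X_1,\dots,X_n^q-X_n)$ is not the zero polynomial.
   Context: The remainder of $F$ modulo $(X_1^q-X_1,\dots,X_n^q-X_n)$ is the remainder produced by the multivariate division algorithm (it is independent of the monomial ordering). Equivalently, it is the polynomial obtained from $F$ by repeatedly replacing a factor $X_i^q$ occurring in some term by $X_i$, until the degree in each $X_i$ is less than $q$. *)

(* Defs.v *)
From mathcomp Require Import all_boot all_order all_algebra.
From mathcomp Require Import mpoly.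

Set Implicit Arguments.
Unset Strict Implicit.
Unset Printing Implicit Defensive.

Import Order.TTheory GRing.Theory.
Local Open Scope ring_scope.

Section MultivariateDivision.

Variables (K : fieldType) (n : nat).
Implicit Types (p r f g h : {mpoly K[n]}) (gs : seq {mpoly K[n]}).

(* One step of the multivariate division algorithm by gs, for the
   graded monomial ordering underlying [mlead].  A state (p, r) consists of the
   dividend p still to be treated and the remainder r accumulated so far. *)
Definition mdiv_step gs (s : {mpoly K[n]} * {mpoly K[n]}) :=
  let: (p, r) := s in
  if p == 0 then s else
  if [seq g <- gs | (g != 0) && (mlead g <= mlead p)%MM] is g :: _
  then (p - (mleadc p / mleadc g) *: 'X_[mlead p - mlead g] * g, r)
  else (p - mleadc p *: 'X_[mlead p], r + mleadc p *: 'X_[mlead p]).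

(* Each step lowers the leading monomial of the dividend, and the ordering is
   graded, so the dividend is exhausted after at most as many steps as there
   are monomials of degree at most that of f (see [mdiv_terminates]). *)
Definition mdiv gs f :=
  iter #|{: 'X_{1..n < msize f}}| (mdiv_step gs) (f, 0).

Definition mrem gs f : {mpoly K[n]} := (mdiv gs f).2.

Lemma mlead_cancel p h :
    mlead h = mlead p -> mleadc h = mleadc p -> p - h != 0 ->
  (mlead (p - h) < mlead p)%O.
Proof.
move=> eq_m eq_c nz; rewrite lt_neqAle; apply/andP; split; last first.
  by have := mleadB_le p h; rewrite eq_m joinxx.
apply: contraNneq nz => eq_mB.
by rewrite -mleadc_eq0 eq_mB mcoeffB -[in h@__]eq_m eq_c subrr.
Qed.

Lemma mdiv_step_lt gs p r :
    p != 0 -> (mdiv_step gs (p, r)).1 != 0 ->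
  (mlead (mdiv_step gs (p, r)).1 < mlead p)%O.
Proof.
move=> nz_p; rewrite /mdiv_step (negPf nz_p).
have nz_lc : mleadc p != 0 by rewrite mleadc_eq0.
case E: [seq g <- gs | _] => [|g gs'] /=.
  by apply: mlead_cancel; rewrite mleadZ // mleadXm // mcoeffZ mcoeffX eqxx mulr1.
have: g \in [seq g <- gs | (g != 0) && (mlead g <= mlead p)%MM].
  by rewrite E mem_head.
rewrite mem_filter => /andP[/andP[nz_g le_gp] _].
have nz_lcg : mleadc g != 0 by rewrite mleadc_eq0.
have nz_c : mleadc p / mleadc g != 0 by rewrite mulf_neq0 ?invr_neq0.
have nz_X : (mleadc p / mleadc g) *: 'X_[mlead p - mlead g] != 0 :> {mpoly K[n]}.
  by rewrite -mleadc_eq0 mleadZ // mleadXm mcoeffZ mcoeffX eqxx mulr1.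
have eq_m : mlead ((mleadc p / mleadc g) *: 'X_[mlead p - mlead g] * g) = mlead p.
  by rewrite mleadM // mleadZ // mleadXm submK.
apply: mlead_cancel => //.
rewrite mleadM // mleadcM mleadZ // mleadXm mcoeffZ mcoeffX eqxx mulr1.
by rewrite divfK.
Qed.

Lemma mdiv_terminates gs f : (mdiv gs f).1 = 0.
Proof.
rewrite /mdiv; set b := msize f.
pose below (m : 'X_{1..n}) := [pred x : 'X_{1..n < b} | (bmnm x <= m)%O].
have step0 s : s.1 = 0 -> (mdiv_step gs s).1 = 0.
  by case: s => p r /= ->; rewrite eqxx.
suff key k p r : p = 0 \/ (mdeg (mlead p) < b)%N /\ (#|below (mlead p)| <= k)%N ->
    (iter k (mdiv_step gs) (p, r)).1 = 0.
  apply: key; case: (eqVneq f 0) => [->|nz_f]; [by left | right].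
  by split; [rewrite /b mlead_deg | apply: max_card].
have iter0 j s : s.1 = 0 -> (iter j (mdiv_step gs) s).1 = 0.
  by move=> s0; elim: j => //= j IHj; apply: step0.
elim: k p r => [|k IHk] p r [p0 | [lt_b card_k]]; try exact: iter0.
  move: card_k; rewrite leqn0 => /eqP/card0_eq/(_ (BMultinom lt_b)).
  by rewrite inE /= lexx.
case: (eqVneq p 0) => [p0|nz_p]; first exact: iter0.
rewrite iterSr; case E: (mdiv_step gs (p, r)) => [p' r'].
apply: IHk; case: (eqVneq p' 0) => [|nz_p']; [by left | right].
have lt_p : (mlead p' < mlead p)%O.
  by have := @mdiv_step_lt gs p r nz_p; rewrite E; apply.
split; first exact: leq_ltn_trans (lemc_mdeg (ltW lt_p)) lt_b.
rewrite -ltnS; apply: leq_trans card_k; apply: proper_card.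
apply/properP; split.
  by apply/subsetP=> x; rewrite !inE => /le_trans; apply; apply: ltW.
by exists (BMultinom lt_b); rewrite !inE /= ?lexx // -ltNge.
Qed.

End MultivariateDivision.

Definition field_polys (K : finFieldType) (n : nat) : seq {mpoly K[n]} :=
  [seq 'X_i ^+ #|K| - 'X_i | i <- enum 'I_n].

(* Main.v *)
Require Import Defs.
From mathcomp Require Import all_boot all_order all_algebra.
From mathcomp Require Import finfield.
From mathcomp Require Import mpoly.

(** Division by the polynomials [X_i^q - X_i], which vanish on all of [K^n],
    does not change the values of [F], and it leaves a remainder of degree less
    than [q] in each variable.  Such a reduced polynomial is determined by its
    values: by Lagrange interpolation on the whole field [K], each functional
    "coefficient of [X^k]" on univariate polynomials of degree less than [q] is
    a weighted sum of values, and products of these weights extract the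
    coefficients of a reduced polynomial in [n] variables. *)

Set Implicit Arguments.
Unset Strict Implicit.
Unset Printing Implicit Defensive.

Import Order.TTheory GRing.Theory.
Local Open Scope ring_scope.

Section Remainder.

Variables (K : fieldType) (n : nat).
Implicit Types (f g : {mpoly K[n]}) (gs : seq {mpoly K[n]}).

(** A step either moves a term from the dividend to the remainder or subtracts a multiple of some
    [g] vanishing at [v]. *)
Lemma meval_mdiv_step gs (v : 'I_n -> K) s :
    {in gs, forall g, g.@[v] = 0} ->
  (mdiv_step gs s).1.@[v] + (mdiv_step gs s).2.@[v] = s.1.@[v] + s.2.@[v].
Proof.
case: s => p r gs0; rewrite /mdiv_step; case: eqP => // _.
case E: [seq g <- gs | _] => [|g gs'] /=.
  by rewrite mevalB mevalD addrACA addNr addr0.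
have: g \in [seq g <- gs | (g != 0) && (mlead g <= mlead p)%MM].
  by rewrite E mem_head.
by rewrite mem_filter => /andP[_ /gs0 g0]; rewrite mevalB mevalM g0 mulr0 subr0.
Qed.

Lemma meval_mrem gs f (v : 'I_n -> K) :
  {in gs, forall g, g.@[v] = 0} -> (mrem gs f).@[v] = f.@[v].
Proof.
(* The final dividend is [0]; adding its value turns the left side into the sum that each step
   preserves. *)
move=> gs0; rewrite /mrem -[LHS]add0r -(meval0 v) -(mdiv_terminates gs f).
rewrite /mdiv; elim: #|_| => [|k IHk]; first by rewrite /= meval0 addr0.
by rewrite iterS meval_mdiv_step.
Qed.

(** A term enters the remainder only when no leading monomial of a nonzero divisor divides it. *)
Lemma mrem_reduced gs f g m :
  g \in gs -> g != 0 -> m \in msupp (mrem gs f) -> ~~ (mlead g <= m)%MM.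
Proof.
move=> gs_g nz_g; rewrite /mrem /mdiv; elim: #|_| m => [|k IHk] m.
  by rewrite msupp0.
rewrite iterS; case: (iter k _ _) IHk => p r /= IHk; rewrite /mdiv_step.
case: eqP => [_ /IHk //|/eqP nz_p].
case E: [seq g <- gs | _] => [|g' gs'] /= => [|/IHk //].
move/msuppD_le; rewrite mem_cat => /orP[/IHk //|/msuppZ_le].
rewrite msuppX inE => /eqP ->; apply/negP => le_gp.
have: g \in [seq g <- gs | (g != 0) && (mlead g <= mlead p)%MM].
  by rewrite mem_filter nz_g le_gp.
by rewrite E.
Qed.

End Remainder.

Section FieldPolynomials.

Variables (K : finFieldType) (n : nat).

Lemma meval_field_polys (v : 'I_n -> K) :
  {in field_polys K n, forall g, g.@[v] = 0}.
Proof.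
move=> _ /mapP[i _ ->].
by rewrite mevalB rmorphXn /= mevalXU expf_card subrr.
Qed.

Lemma mlead_field_poly (i : 'I_n) :
  mlead ('X_i ^+ #|K| - 'X_i : {mpoly K[n]}) = (U_(i) *+ #|K|)%MM.
Proof.
rewrite mleadDl mpolyXn mleadXm // mleadN mleadXm lt_mdeg_ltmc //.
by rewrite mdegMn mdeg1 mul1n finNzRing_gt1.
Qed.

Lemma mrem_field_polys_lt (F : {mpoly K[n]}) m (i : 'I_n) :
  m \in msupp (mrem (field_polys K n) F) -> (m i < #|K|)%N.
Proof.
set g : {mpoly K[n]} := 'X_i ^+ #|K| - 'X_i => supp_m.
have gs_g : g \in field_polys K n by apply: map_f; rewrite mem_enum.
have nz_g : g != 0.
  (* If [g] were zero, its leading exponent at [i] would be both [0] and [q]. *)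
  apply: contraTneq (finNzRing_gt1 K) => g0.
  have := mlead_field_poly i; rewrite -/g g0 mlead0 => /mnmP/(_ i).
  by rewrite mnm0E mulmnE mnm1E eqxx mul1n => <-.
rewrite ltnNge; apply: contra (mrem_reduced gs_g nz_g supp_m) => le_qm.
rewrite mlead_field_poly; apply/mnm_lepP => j.
by rewrite mulmnE mnm1E; case: eqP => [<-|_]; rewrite ?mul1n.
Qed.

(* The [k]-th coefficient of the Lagrange polynomial [1 - (X - a)^(q-1)], which
   is [1] at [a] and [0] elsewhere. *)
Definition lagrange_coef (k : nat) (a : K) : K :=
  (1 - ('X - a%:P) ^+ #|K|.-1)`_k.

(** Since [j < q], [X^j] equals its interpolant on all of [K]; compare the coefficients of [X^k]. *)
Lemma sum_lagrange_coef k j :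
  (j < #|K|)%N -> \sum_(a : K) lagrange_coef k a * a ^+ j = (j == k)%:R.
Proof.
move=> lt_jq; pose L a : {poly K} := 1 - ('X - a%:P) ^+ #|K|.-1.
have q_gt0 : (0 < #|K|)%N by apply: leq_ltn_trans lt_jq.
have sizeL a : (size (L a) <= #|K|)%N.
  rewrite (leq_trans (size_polyD _ _)) // geq_max size_poly1 q_gt0 size_polyN.
  by rewrite size_exp_XsubC prednK /=.
have evalL a b : (L a).[b] = (a == b)%:R.
  rewrite !hornerE; have [->|neq_ab] := eqVneq a b.
    (* The power [0^(q-1)] is [0], not [1], because [q > 1]. *)
    rewrite subrr expr0n -subn1 subn_eq0 leqNgt.
    by rewrite finNzRing_gt1 subr0.
  have nz : b - a != 0 by rewrite subr_eq0 eq_sym.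
  by rewrite -[_ ^+ _](mulfK nz) -exprSr prednK // expf_card divff // subrr.
suff /(congr1 (coefp k)) : \sum_a a ^+ j *: L a = 'X^j.
  rewrite /= coefXn coef_sum eq_sym => <-.
  by apply: eq_bigr => a _; rewrite coefZ mulrC.
(* A nonzero difference would have [q] roots, hence size above [q]; the interpolant has size at most
   [q], which forces [q <= j]. *)
apply/eqP; rewrite -subr_eq0; apply: contraTT lt_jq => nz_d; rewrite -leqNgt.
set d := _ - _ in nz_d; have roots_d : all (root d) (enum K).
  apply/allP => b _; rewrite /root hornerD hornerN hornerXn horner_sum.
  rewrite (bigD1 b) //= hornerZ evalL eqxx mulr1 big1 ?addr0 ?subrr // => a nab.
  by rewrite hornerZ evalL (negPf nab) mulr0.
have := max_poly_roots nz_d roots_d (enum_uniq _).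
rewrite -cardE => /leq_trans/(_ (size_polyD _ _)).
rewrite size_polyN size_polyXn leq_max => /orP[|//].
rewrite ltnNge (leq_trans (size_sum _ _ _)) //.
by apply/bigmax_leqP => a _; apply: leq_trans (size_scale_leq _ _) (sizeL a).
Qed.

Lemma reduced_mcoeff (p : {mpoly K[n]}) m :
    (forall m' i, m' \in msupp p -> (m' i < #|K|)%N) ->
  p@_m = \sum_(x : {ffun 'I_n -> K})
           p.@[x] * \prod_i lagrange_coef (m i) (x i).
Proof.
move=> red_p; under eq_bigr do rewrite mevalE mulr_suml.
rewrite exchange_big [in LHS](mpolyE p) raddf_sum /=.
apply: eq_big_seq => m' supp_m'; rewrite mcoeffZ mcoeffX.
under eq_bigr do rewrite -mulrA -big_split /=.
rewrite -mulr_sumr.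
(* For a fixed monomial, the sum over [K^n] factors into univariate sums, one per coordinate. *)
rewrite -(bigA_distr_bigA (fun i a => a ^+ m' i * lagrange_coef (m i) a)).
congr (_ * _); under eq_bigr => i _.
  under eq_bigr do rewrite mulrC.
  rewrite sum_lagrange_coef ?red_p //; over.
rewrite -natr_prod; congr _%:R.
have [->|neq_m] := eqVneq; first by rewrite big1 // => i _; rewrite eqxx.
have /existsP[i /negPf neq_i] : [exists i, m' i != m i].
  apply: contraNT neq_m; rewrite negb_exists => /forallP eq_m.
  by apply/eqP/mnmP => i; apply/eqP; rewrite -[_ == _]negbK.
by rewrite (bigD1 i) //= neq_i mul0n.
Qed.

Lemma reduced_eq0 (p : {mpoly K[n]}) :
    (forall m i, m \in msupp p -> (m i < #|K|)%N) ->
  (forall x : 'I_n -> K, p.@[x] = 0) -> p = 0.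
Proof.
move=> red_p p0; apply/mpolyP => m; rewrite mcoeff0 reduced_mcoeff //.
by rewrite big1 // => x _; rewrite p0 mul0r.
Qed.

End FieldPolynomials.

Theorem proposition2 (K : finFieldType) (n : nat) (F : {mpoly K[n]}) :
  (exists x : 'I_n -> K, F.@[x] <> 0) <-> mrem (field_polys K n) F <> 0.
Proof.
have evalE x := meval_mrem F (@meval_field_polys K n x).
split=> [[x nzFx] r0 | /eqP nz_r]; first by apply: nzFx; rewrite -evalE r0 meval0.
(* Finite functions form a finite type, so the existence of a point is decidable. *)
have [/existsP[x nzFx]|] := boolP [exists x : {ffun 'I_n -> K}, F.@[x] != 0].
  by exists x; apply/eqP.
rewrite negb_exists => /forallP F0; case/eqP: nz_r.
apply: reduced_eq0 => [m i|x]; first exact: mrem_field_polys_lt.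
rewrite evalE -(meval_eq (v1 := [ffun i => x i])) => [|i]; last by rewrite ffunE.
by apply/eqP; rewrite -[_ == _]negbK.
Qed.
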